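(* Suppose $\{u_i^k,v_i^k\mid 1\le i\le M,\ 0\le k\le N\}$ is the solution of the compact difference scheme given in the context. Then $$\|u^k\|^2\le 2\Big(\|u^0\|^2+\mu|u^0|_1^2+\frac{\mu h^2}{12}\|v^0\|^2-\frac{\mu h^4}{144}|v^0|_1^2\Big),\qquad 1\le k\le N.$$
   Context: Parameters: $\mu$ and $\gamma$ are non-negative constants, $\kappa$ and $\nu$ are (real) parameters, $L$ is the spatial period, $(0,T]$ is the time interval, and $\varphi:\mathbb R\to\mathbb R$ is an $L$-periodic function. $M,N$ are positive integers, $h=L/M$, $\tau=T/N$, $x_i=ih$ ($i\in\mathbb Z$), $t_k=k\tau$. Notation for grid functions: $\delta_xu_{i+1/2}=\frac1h(u_{i+1}-u_i)$, $\delta_x^2u_i=\frac1{h^2}(u_{i+1}-2u_i+u_{i-1})$, $\Delta_xu_i=\frac1{2h}(u_{i+1}-u_{i-1})$, $u^{k+1/2}=\frac12(u^k+u^{k+1})$, $u^{\bar k}=\frac12(u^{k-1}+u^{k+1})$, $\delta_tu^{k+1/2}=\frac1\tau(u^{k+1}-u^k)$, $\Delta_tu^k=\frac1{2\tau}(u^{k+1}-u^{k-1})$, $\psi(u,v)_i=\frac13[u_i\Delta_xv_i+\Delta_x(uv)_i]$. For $M$-periodic grid functions ($u_{i+M}=u_i$): $\|u\|=\big(h\sum_{i=1}^Mu_i^2\big)^{1/2}$, $|u|_1=\big(h\sum_{i=1}^M(\delta_xu_{i-1/2})^2\big)^{1/2}$. Compact difference scheme (for the equation $u_t-\mu u_{xxt}+\gamma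 uu_x+\kappa u_x-\nu u_{xx}=0$ with $L$-periodic boundary condition and initial value $\varphi$). Grid functions $u_i^k,v_i^k$ ($0\le k\le N$), $M$-periodic in $i$, with $u_i^0=\varphi(x_i)$ and, for $1\le i\le M$: (1) $\delta_tu_i^{1/2}-\mu\delta_tv_i^{1/2}+\gamma\big[\psi(u^0,u^{1/2})_i-\frac{h^2}2\psi(v^0,u^{1/2})_i\big]+\kappa\big(\Delta_xu_i^{1/2}-\frac{h^2}6\Delta_xv_i^{1/2}\big)-\nu v_i^{1/2}=0$; (2) $\Delta_tu_i^k-\mu\Delta_tv_i^k+\gamma\big[\psi(u^k,u^{\bar k})_i-\frac{h^2}2\psi(v^k,u^{\bar k})_i\big]+\kappa\big(\Delta_xu_i^{\bar k}-\frac{h^2}6\Delta_xv_i^{\bar k}\big)-\nu v_i^{\bar k}=0$ for $1\le k\le N-1$; (3) $v_i^k=\delta_x^2u_i^k-\frac{h^2}{12}\delta_x^2v_i^k$ for $0\le k\le N$.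
   Formalization: The parameter ν is assumed non-negative; for ν<0 the estimate fails, e.g. μ=γ=κ=0, ν=−1, L=M=2, N=1, T=1/6, φ(x)=cos(πx) gives u^1=3u^0, so ‖u^1‖²=18 while the bound is 4. *)

(* Defs.v *)
From mathcomp Require Import all_boot all_order all_algebra.
From mathcomp Require Import reals trigo.

Set Implicit Arguments.
Unset Strict Implicit.
Unset Printing Implicit Defensive.

Import Order.TTheory GRing.Theory Num.Theory.
Local Open Scope ring_scope.

(* A grid function is a total function int -> R; its M-periodicity is a        *)
(* separate hypothesis. A space-time grid function is w : nat -> int -> R,     *)
(* where w k i stands for w_i^k.                                               *)

Section SpaceOperators.
Variables (R : realType) (h : R).
Implicit Types (u v : int -> R) (i : int).

(* deltax u i is delta_x u_{i+1/2}, hence delta_x u_{i-1/2} is deltax u (i-1). *)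
Definition deltax u i : R := (u (i + 1) - u i) / h.

Definition deltax2 u i : R := (u (i + 1) - 2 * u i + u (i - 1)) / h ^+ 2.

Definition Deltax u i : R := (u (i + 1) - u (i - 1)) / (2 * h).

Definition psi u v i : R :=
  (u i * Deltax v i + Deltax (fun j => u j * v j) i) / 3.

Definition grid_norm (M : nat) u : R :=
  Num.sqrt (h * \sum_(1 <= i < M.+1) u i%:Z ^+ 2).

Definition grid_seminorm1 (M : nat) u : R :=
  Num.sqrt (h * \sum_(1 <= i < M.+1) deltax u (i%:Z - 1) ^+ 2).

End SpaceOperators.

Section TimeOperators.
Variables (R : realType) (tau : R).
Implicit Types (w : nat -> int -> R) (k : nat) (i : int).

(* w^{k+1/2} *)
Definition avg_half w k i : R := (w k i + w k.+1 i) / 2.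

(* w^{\bar k}, meaningful for 1 <= k only *)
Definition avg_bar w k i : R := (w k.-1 i + w k.+1 i) / 2.

(* delta_t w^{k+1/2} *)
Definition deltat w k i : R := (w k.+1 i - w k i) / tau.

(* Delta_t w^k, meaningful for 1 <= k only *)
Definition Deltat w k i : R := (w k.+1 i - w k.-1 i) / (2 * tau).

End TimeOperators.

(* Only the time levels 0 <= k <= N of u and v are constrained. *)
Record compact_scheme_solution (R : realType) (mu gamma kappa nu L T : R)
    (phi : R -> R) (M N : nat) (u v : nat -> int -> R) : Prop :=
  CompactSchemeSolution {
    scheme_periodic_u : forall k : nat, (k <= N)%N -> periodic (u k) M%:Z;
    scheme_periodic_v : forall k : nat, (k <= N)%N -> periodic (v k) M%:Z;
    scheme_initial : forall i : int, u 0 i = phi (i%:~R * (L / M%:R));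
    scheme_first_step :
      let h := L / M%:R in let tau := T / N%:R in
      let uh := avg_half u 0 in let vh := avg_half v 0 in
      forall i : int, 1 <= i <= M%:Z ->
        deltat tau u 0 i - mu * deltat tau v 0 i
        + gamma * (psi h (u 0) uh i - h ^+ 2 / 2 * psi h (v 0) uh i)
        + kappa * (Deltax h uh i - h ^+ 2 / 6 * Deltax h vh i)
        - nu * vh i = 0;
    scheme_step :
      let h := L / M%:R in let tau := T / N%:R in
      forall k : nat, (1 <= k <= N.-1)%N ->
      let ub := avg_bar u k in let vb := avg_bar v k in
      forall i : int, 1 <= i <= M%:Z ->
        Deltat tau u k i - mu * Deltat tau v k i
        + gamma * (psi h (u k) ub i - h ^+ 2 / 2 * psi h (v k) ub i)
        + kappa * (Deltax h ub i - h ^+ 2 / 6 * Deltax h vb i)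
        - nu * vb i = 0;
    scheme_compact :
      let h := L / M%:R in
      forall k : nat, (k <= N)%N ->
      forall i : int, 1 <= i <= M%:Z ->
        v k i = deltax2 h (u k) i - h ^+ 2 / 12 * deltax2 h (v k) i
  }.

(* Main.v *)
(* Write (f, g) for the discrete inner product over one period and test each    *)
(* step of the scheme with the averaged solution. The terms in gamma and kappa  *)
(* vanish by antisymmetry of the central difference, so the energy              *)
(* E^k = (u^k, u^k) - mu (v^k, u^k) satisfies E^1 <= E^0 and                    *)
(* E^{k+1} <= E^{k-1}: this uses that (v, u') is a symmetric form on pairs      *)
(* satisfying the compact relation, and that with c = h^2/12                    *)
(*   -(v, u) = |u|_1^2 + c ||v||^2 - c^2 |v|_1^2 >= 0,                          *)
(* by the inverse inequality |v|_1^2 <= 4/h^2 ||v||^2. The same two facts give  *)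
(* ||u^k||^2 <= E^k and identify E^0 with the bracket of the estimate.          *)
Require Import Defs.
From mathcomp Require Import all_boot all_order all_algebra.
From mathcomp Require Import reals trigo.
From mathcomp Require Import ring lra zify.

Set Implicit Arguments.
Unset Strict Implicit.
Unset Printing Implicit Defensive.

Import Order.TTheory GRing.Theory Num.Theory.
Local Open Scope ring_scope.

(** The core is [energy_step]. Testing with the time average turns the difference quotients into a
    difference of energies [dot M u u - mu * dot M v u]. Convection drops out by [dot_psi],
    [dot_Deltax_self] and [compact_dot_Deltax], and the [nu] term only dissipates by
    [compact_dot_le0]. The identity [compact_dot] supplies both the symmetry that cancels the cross
    terms and the formula for the initial energy. *)

(** The weight [h] of the discrete inner product is left out; it returns in [sqr_grid_norm]. *)
Definition dot (R : realType) (M : nat) (f g : int -> R) : R :=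
  \sum_(1 <= i < M.+1) f i%:Z * g i%:Z.

(** Imposed at every integer, not just on one period, so that it can be used at the neighbours of a
    grid point. *)
Definition compact_pair (R : realType) (h : R) (u v : int -> R) : Prop :=
  forall i, v i = deltax2 h u i - h ^+ 2 / 12 * deltax2 h v i.

(** * Periodic grid functions *)

Lemma periodic_pred (T : zmodType) (M : nat) (f : int -> T) i :
  periodic f M%:Z -> f (i + M%:Z - 1) = f (i - 1).
Proof. by move=> pf; rewrite -(pf (i - 1)) addrAC. Qed.

Lemma periodic_succ (T : zmodType) (M : nat) (f : int -> T) i :
  periodic f M%:Z -> f (i + M%:Z + 1) = f (i + 1).
Proof. by move=> pf; rewrite -(pf (i + 1)) addrAC. Qed.

Lemma periodic_mulz (T : zmodType) (M : nat) (f : int -> T) (q i : int) :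
  periodic f M%:Z -> f (i + q * M%:Z) = f i.
Proof.
move=> pf; elim/int_rec: q => [|n IH|n IH]; first by rewrite mul0r addr0.
  by rewrite -[n.+1]addn1 PoszD mulrDl mul1r addrA pf.
rewrite -[in LHS]pf -[n.+1]addn1 PoszD opprD mulrDl mulN1r -IH.
by congr f; ring.
Qed.

Lemma periodic_eq (T : zmodType) (M : nat) (f g : int -> T) :
  (0 < M)%N -> periodic f M%:Z -> periodic g M%:Z ->
  (forall i : int, 1 <= i <= M%:Z -> f i = g i) -> forall i, f i = g i.
Proof.
move=> M_gt0 pf pg fg i.
have M0 : M%:Z != 0 by rewrite eqz_nat -lt0n.
(* Shifting by 1 turns residues in [0..M-1] into representatives in [1..M]. *)
have -> : i = ((i - 1) %% M%:Z)%Z + 1 + ((i - 1) %/ M%:Z)%Z * M%:Z.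
  by have := divz_eq (i - 1) M%:Z; lra.
rewrite !periodic_mulz //; apply: fg.
have := modz_ge0 (i - 1) M0; have := ltz_pmod (i - 1) (_ : 0 < M%:Z).
by rewrite ltz_nat => /(_ M_gt0); lia.
Qed.

Lemma sum_periodic_diff (R : realType) (M : nat) (G : int -> R) :
  periodic G M%:Z -> \sum_(1 <= i < M.+1) (G (i%:Z + 1) - G i%:Z) = 0.
Proof.
move=> pG.
under eq_bigr => i _ do rewrite -PoszD addn1.
rewrite (telescope_sumr (fun i : nat => G i%:Z)) //.
by rewrite -[M.+1]addn1 addnC PoszD pG subrr.
Qed.

(* Every discrete integration by parts reduces to exhibiting the periodic      *)
(* [G] whose forward difference is the integrand.                              *)
Lemma sum_eq_diff (R : realType) (M : nat) (F G : int -> R) :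
  periodic G M%:Z -> (forall i, F i = G (i + 1) - G i) ->
  \sum_(1 <= i < M.+1) F i%:Z = 0.
Proof.
by move=> pG FG; under eq_bigr do rewrite FG; exact: sum_periodic_diff.
Qed.

(** * Discrete integration by parts *)

Lemma dotC (R : realType) (M : nat) (f g : int -> R) : dot M f g = dot M g f.
Proof. by rewrite /dot; under eq_bigr do rewrite mulrC. Qed.

Lemma dot_ge0 (R : realType) (M : nat) (f : int -> R) : 0 <= dot M f f.
Proof. by apply: sumr_ge0 => i _; rewrite -expr2 sqr_ge0. Qed.

Lemma dot_deltax2_sym (R : realType) (h : R) (M : nat) (f g : int -> R) :
  periodic f M%:Z -> periodic g M%:Z ->
  dot M (deltax2 h f) g = dot M f (deltax2 h g).
Proof.
move=> pf pg; apply/eqP; rewrite -subr_eq0 -sumrB; apply/eqP.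
pose G i := (f i * g (i - 1) - f (i - 1) * g i) / h ^+ 2.
apply: (@sum_eq_diff _ _ (fun i => deltax2 h f i * g i - f i * deltax2 h g i) G).
  by move=> i; rewrite /G pf pg !periodic_pred.
by move=> i; rewrite /G /deltax2 addrK; ring.
Qed.

Lemma dot_deltax2 (R : realType) (h : R) (M : nat) (f : int -> R) :
  periodic f M%:Z ->
  dot M (deltax2 h f) f = - \sum_(1 <= i < M.+1) deltax h f (i%:Z - 1) ^+ 2.
Proof.
move=> pf; apply/eqP; rewrite -addr_eq0 -big_split; apply/eqP.
pose G i := (f i * f (i - 1) - f (i - 1) ^+ 2) / h ^+ 2.
apply: (@sum_eq_diff _ _
  (fun i => deltax2 h f i * f i + deltax h f (i - 1) ^+ 2) G).
  by move=> i; rewrite /G pf !periodic_pred.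
by move=> i; rewrite /G /deltax2 /deltax [i + 1 - 1]addrK [i - 1 + 1]subrK expr_div_n; ring.
Qed.

Lemma sum_deltax_sqr_le (R : realType) (h : R) (M : nat) (f : int -> R) :
  periodic f M%:Z ->
  \sum_(1 <= i < M.+1) deltax h f (i%:Z - 1) ^+ 2 <= 4 / h ^+ 2 * dot M f f.
Proof.
move=> pf; rewrite -subr_ge0.
have pG : periodic (fun i => 2 * f (i - 1) ^+ 2 / h ^+ 2) M%:Z.
  by move=> i; rewrite periodic_pred.
(* Subtracting a telescoping sum of zero replaces [4 a^2] by [2 a^2 + 2 b^2], with [b] the left
   neighbour of [a]; what remains beyond [(a - b)^2] is [(a + b)^2]. *)
rewrite -[leRHS]subr0 -[X in _ <= _ - X](sum_periodic_diff pG) /dot mulr_sumr -!sumrB /=.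
apply: sumr_ge0 => i _.
rewrite /deltax [_ + 1 - 1]addrK [_ - 1 + 1]subrK expr_div_n.
have -> : 4 / h ^+ 2 * (f i%:Z * f i%:Z)
    - (f i%:Z - f (i%:Z - 1)) ^+ 2 / h ^+ 2
    - (2 * f i%:Z ^+ 2 / h ^+ 2 - 2 * f (i%:Z - 1) ^+ 2 / h ^+ 2)
    = (f i%:Z + f (i%:Z - 1)) ^+ 2 / h ^+ 2 by ring.
by rewrite divr_ge0 ?sqr_ge0.
Qed.

Lemma dot_Deltax_antisym (R : realType) (h : R) (M : nat) (f g : int -> R) :
  periodic f M%:Z -> periodic g M%:Z ->
  dot M (Deltax h f) g = - dot M f (Deltax h g).
Proof.
move=> pf pg; apply/eqP; rewrite -addr_eq0 -big_split; apply/eqP.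
pose G i := (f i * g (i - 1) + f (i - 1) * g i) / (2 * h).
apply: (@sum_eq_diff _ _ (fun i => Deltax h f i * g i + f i * Deltax h g i) G).
  by move=> i; rewrite /G pf pg !periodic_pred.
by move=> i; rewrite /G /Deltax addrK; ring.
Qed.

Lemma dot_Deltax_self (R : realType) (h : R) (M : nat) (f : int -> R) :
  periodic f M%:Z -> dot M (Deltax h f) f = 0.
Proof. by move=> pf; have := dot_Deltax_antisym h pf pf; rewrite (dotC M f); lra. Qed.

(** The 1/3 weighting of the advective and conservative forms makes the integrand the difference of
    the flux [G], whatever the transporting function [f]; hence it serves for both [u] and [v] in
    that role. *)
Lemma dot_psi (R : realType) (h : R) (M : nat) (f g : int -> R) :
  periodic f M%:Z -> periodic g M%:Z -> dot M (psi h f g) g = 0.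
Proof.
move=> pf pg.
pose G i := g i * g (i - 1) * (f i + f (i - 1)) / (2 * h) / 3.
apply: (@sum_eq_diff _ _ (fun i => psi h f g i * g i) G).
  by move=> i; rewrite /G pf pg !periodic_pred.
by move=> i; rewrite /G /psi /Deltax addrK; ring.
Qed.

(** * The bilinear form of the compact relation *)

(** Substitute the relation for [v1], move [deltax2] from [v1] onto [u2], then substitute the
    relation for [deltax2 h u2]. Each resulting term is symmetric under exchanging the two pairs. *)
Lemma compact_dot (R : realType) (h : R) (M : nat) (u1 v1 u2 v2 : int -> R) :
  periodic v1 M%:Z -> periodic u2 M%:Z ->
  compact_pair h u1 v1 -> compact_pair h u2 v2 ->
  dot M v1 u2 = dot M (deltax2 h u1) u2 - h ^+ 2 / 12 * dot M v1 v2
    - (h ^+ 2 / 12) ^+ 2 * dot M v1 (deltax2 h v2).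
Proof.
move=> pv1 pu2 c1 c2; set c := h ^+ 2 / 12.
have -> : dot M v1 u2 = dot M (deltax2 h u1) u2 - c * dot M (deltax2 h v1) u2.
  by rewrite /dot mulr_sumr -sumrB; apply: eq_bigr => i _; rewrite {1}c1 -/c; ring.
have -> : dot M (deltax2 h v1) u2 = dot M v1 v2 + c * dot M v1 (deltax2 h v2).
  rewrite dot_deltax2_sym // /dot mulr_sumr -big_split /=.
  by apply: eq_bigr => i _; rewrite c2 -/c; ring.
by ring.
Qed.

Lemma compact_dot_sym (R : realType) (h : R) (M : nat) (u1 v1 u2 v2 : int -> R) :
  periodic u1 M%:Z -> periodic v1 M%:Z -> periodic u2 M%:Z ->
  periodic v2 M%:Z -> compact_pair h u1 v1 -> compact_pair h u2 v2 ->
  dot M v1 u2 = dot M v2 u1.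
Proof.
move=> pu1 pv1 pu2 pv2 c1 c2.
rewrite (compact_dot pv1 pu2 c1 c2) (compact_dot pv2 pu1 c2 c1).
rewrite (dot_deltax2_sym h pu1 pu2) (dotC M u1) (dotC M v1 v2).
by rewrite -(dot_deltax2_sym h pv1 pv2) (dotC M (deltax2 h v1)).
Qed.

Lemma compact_dot_energy (R : realType) (h : R) (M : nat) (u v : int -> R) :
  periodic u M%:Z -> periodic v M%:Z -> compact_pair h u v ->
  - dot M v u = \sum_(1 <= i < M.+1) deltax h u (i%:Z - 1) ^+ 2
    + h ^+ 2 / 12 * dot M v v
    - h ^+ 4 / 144 * \sum_(1 <= i < M.+1) deltax h v (i%:Z - 1) ^+ 2.
Proof.
move=> pu pv c.
rewrite (compact_dot pv pu c c) (dotC M v (deltax2 h v)) !dot_deltax2 //.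
by field.
Qed.

Lemma compact_dot_le0 (R : realType) (h : R) (M : nat) (u v : int -> R) :
  h != 0 -> periodic u M%:Z -> periodic v M%:Z -> compact_pair h u v ->
  dot M v u <= 0.
Proof.
move=> h0 pu pv c; rewrite -oppr_ge0 (compact_dot_energy pu pv c).
have su : 0 <= \sum_(1 <= i < M.+1) deltax h u (i%:Z - 1) ^+ 2.
  by apply: sumr_ge0 => i _; rewrite sqr_ge0.
have h4 : 0 <= h ^+ 4 / 144.
  by rewrite divr_ge0 // (exprM h 2 2) sqr_ge0.
have := ler_wpM2l h4 (sum_deltax_sqr_le h pv).
(* The inverse inequality bounds the negative term by [h^2/36], below the available [h^2/12]. *)
have -> : h ^+ 4 / 144 * (4 / h ^+ 2 * dot M v v) = h ^+ 2 / 36 * dot M v v.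
  by field.
have := mulr_ge0 (sqr_ge0 h) (dot_ge0 M v); lra.
Qed.

(* [Deltax] commutes with the compact operator, which is symmetric, while       *)
(* [Deltax] itself is antisymmetric.                                           *)
Lemma compact_dot_Deltax (R : realType) (h : R) (M : nat) (u v : int -> R) :
  periodic u M%:Z -> periodic v M%:Z -> compact_pair h u v ->
  dot M (Deltax h v) u = 0.
Proof.
move=> pu pv c.
have pD w : periodic w M%:Z -> periodic (Deltax h w) M%:Z.
  by move=> pw i; rewrite /Deltax periodic_succ // periodic_pred.
have cD : compact_pair h (Deltax h u) (Deltax h v).
  move=> i; rewrite {1}/Deltax c [v (i - 1)]c /deltax2 /Deltax.
  by rewrite [i + 1 - 1]addrK [i - 1 + 1]subrK; ring.
have := compact_dot_sym (pD _ pu) (pD _ pv) pu pv cD c.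
by have := dot_Deltax_antisym h pv pu; lra.
Qed.

(** * Energy decay and the final estimate *)

(** Covers both kinds of time step: [s] is the time between the two levels, [tau] at the start and
    [2 * tau] afterwards, and [f], [g] are the coefficients frozen at the linearization level. *)
Lemma energy_step (R : realType) (mu gamma kappa nu h s : R) (M : nat)
    (u0 v0 u1 v1 f g : int -> R) :
  let ub i := (u0 i + u1 i) / 2 in let vb i := (v0 i + v1 i) / 2 in
  0 <= nu -> h != 0 -> 0 < s ->
  periodic u0 M%:Z -> periodic v0 M%:Z -> periodic u1 M%:Z ->
  periodic v1 M%:Z -> periodic f M%:Z -> periodic g M%:Z ->
  compact_pair h u0 v0 -> compact_pair h u1 v1 ->
  (forall i : int, 1 <= i <= M%:Z ->
    (u1 i - u0 i) / s - mu * ((v1 i - v0 i) / s)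
    + gamma * (psi h f ub i - h ^+ 2 / 2 * psi h g ub i)
    + kappa * (Deltax h ub i - h ^+ 2 / 6 * Deltax h vb i)
    - nu * vb i = 0) ->
  dot M u1 u1 - mu * dot M v1 u1 <= dot M u0 u0 - mu * dot M v0 u0.
Proof.
move=> ub vb nu0 h0 s0 pu0 pv0 pu1 pv1 pf pg c0 c1 eqn.
have pub : periodic ub M%:Z by move=> i; rewrite /ub pu0 pu1.
have pvb : periodic vb M%:Z by move=> i; rewrite /vb pv0 pv1.
have cb : compact_pair h ub vb.
  by move=> i; rewrite /vb c0 c1 /ub /deltax2; ring.
have : \sum_(1 <= i < M.+1) ((u1 i%:Z - u0 i%:Z) / s
    - mu * ((v1 i%:Z - v0 i%:Z) / s)
    + gamma * (psi h f ub i%:Z - h ^+ 2 / 2 * psi h g ub i%:Z)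
    + kappa * (Deltax h ub i%:Z - h ^+ 2 / 6 * Deltax h vb i%:Z)
    - nu * vb i%:Z) * ub i%:Z = 0.
  rewrite big_nat_cond big1 // => i; rewrite andbT ltnS => iM.
  by rewrite eqn ?mul0r // !lez_nat.
have -> : \sum_(1 <= i < M.+1) ((u1 i%:Z - u0 i%:Z) / s
    - mu * ((v1 i%:Z - v0 i%:Z) / s)
    + gamma * (psi h f ub i%:Z - h ^+ 2 / 2 * psi h g ub i%:Z)
    + kappa * (Deltax h ub i%:Z - h ^+ 2 / 6 * Deltax h vb i%:Z)
    - nu * vb i%:Z) * ub i%:Z
  = (2 * s)^-1 * (dot M u1 u1 - dot M u0 u0 - mu * (dot M v1 u1 - dot M v0 u0
      + (dot M v1 u0 - dot M v0 u1)))
    + gamma * (dot M (psi h f ub) ub - h ^+ 2 / 2 * dot M (psi h g ub) ub)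
    + kappa * (dot M (Deltax h ub) ub - h ^+ 2 / 6 * dot M (Deltax h vb) ub)
    - nu * dot M vb ub.
  rewrite /dot; do ! rewrite ?mulr_sumr -?sumrB -?big_split /=.
  apply: eq_bigr => i _.
  set a := psi h f ub _; set b := psi h g ub _.
  set d := Deltax h ub _; set e := Deltax h vb _.
  by rewrite /ub /vb; field; rewrite gt_eqF.
rewrite !dot_psi // dot_Deltax_self // compact_dot_Deltax //.
(* The cross terms between the two time levels cancel by symmetry. *)
rewrite (compact_dot_sym pu1 pv1 pu0 pv0 c1 c0) subrr addr0.
rewrite !(mulr0, subr0, addr0) => /eqP; rewrite subr_eq0 => /eqP eqE.
have : (2 * s)^-1 * (dot M u1 u1 - dot M u0 u0
    - mu * (dot M v1 u1 - dot M v0 u0)) <= 0.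
  by rewrite eqE mulr_ge0_le0 // (compact_dot_le0 h0 pub pvb cb).
by rewrite pmulr_rle0 ?invr_gt0 ?mulr_gt0 //; lra.
Qed.

Lemma sqr_grid_norm (R : realType) (h : R) (M : nat) (f : int -> R) :
  0 <= h -> grid_norm h M f ^+ 2 = h * dot M f f.
Proof.
move=> h0; rewrite sqr_sqrtr; last first.
  by rewrite mulr_ge0 // sumr_ge0 // => i _; rewrite sqr_ge0.
by congr (h * _); apply: eq_bigr => i _; rewrite expr2.
Qed.

Lemma sqr_grid_seminorm1 (R : realType) (h : R) (M : nat) (f : int -> R) :
  0 <= h -> grid_seminorm1 h M f ^+ 2
    = h * \sum_(1 <= i < M.+1) deltax h f (i%:Z - 1) ^+ 2.
Proof.
by move=> h0; rewrite sqr_sqrtr // mulr_ge0 // sumr_ge0 // => i _; rewrite sqr_ge0.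
Qed.

Theorem mainTheorem6 (R : realType) (mu gamma kappa nu L T : R) (phi : R -> R)
    (M N : nat) (u v : nat -> int -> R)
    (mu_ge0 : 0 <= mu) (gamma_ge0 : 0 <= gamma) (nu_ge0 : 0 <= nu)
    (L_gt0 : 0 < L) (T_gt0 : 0 < T) (M_gt0 : (0 < M)%N) (N_gt0 : (0 < N)%N)
    (phi_periodic : periodic phi L)
    (sol : compact_scheme_solution mu gamma kappa nu L T phi M N u v) :
  let h := L / M%:R in
  forall k : nat, (1 <= k <= N)%N ->
    grid_norm h M (u k) ^+ 2 <=
      2 * (grid_norm h M (u 0%N) ^+ 2 + mu * grid_seminorm1 h M (u 0%N) ^+ 2
           + mu * h ^+ 2 / 12 * grid_norm h M (v 0%N) ^+ 2
           - mu * h ^+ 4 / 144 * grid_seminorm1 h M (v 0%N) ^+ 2).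
Proof.
move=> h k /andP[_ kN].
have h_gt0 : 0 < h by rewrite divr_gt0 // ltr0n.
have h0 : h != 0 by rewrite gt_eqF.
have tau_gt0 : 0 < T / N%:R by rewrite divr_gt0 // ltr0n.
have [pu pv _ first_step step compact] := sol.
have pD2 w : periodic w M%:Z -> periodic (deltax2 h w) M%:Z.
  by move=> pw i; rewrite /deltax2 pw periodic_succ // periodic_pred.
(* Both sides are periodic, so the relation extends from one period to all integers. *)
have cp j : (j <= N)%N -> compact_pair h (u j) (v j).
  move=> jN; apply: (periodic_eq M_gt0 (pv j jN)); last exact: compact.
  by move=> i; rewrite (pD2 _ (pu j jN)) (pD2 _ (pv j jN)).
pose E j := dot M (u j) (u j) - mu * dot M (v j) (u j).
have E1 : E 1%N <= E 0%N.
  by apply: (energy_step nu_ge0 h0 tau_gt0 (pu 0%N _) (pv 0%N _) (pu 1%N _)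
    (pv 1%N _) (pu 0%N _) (pv 0%N _) (cp 0%N _) (cp 1%N _) first_step) => //.
have E2 j : (j.+2 <= N)%N -> E j.+2 <= E j.
  move=> jN; have jN1 := ltnW jN; have jN0 := ltnW jN1.
  have tau2 : 0 < 2 * (T / N%:R) by rewrite mulr_gt0.
  apply: (energy_step nu_ge0 h0 tau2 (pu _ jN0) (pv _ jN0) (pu _ jN) (pv _ jN)
    (pu _ jN1) (pv _ jN1) (cp _ jN0) (cp _ jN) (step j.+1 _)).
  lia.
(* The decay links levels two apart, so the induction carries two consecutive levels; [E1] starts
   the odd ones. *)
have EE j : ((j <= N)%N -> E j <= E 0%N) /\ ((j.+1 <= N)%N -> E j.+1 <= E 0%N).
  elim: j => [|j [IH0 IH1]]; first by [].
  split=> // jN; apply: le_trans (E2 j jN) (IH0 _).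
  exact: ltnW (ltnW jN).
have energy_ge j : (j <= N)%N -> dot M (u j) (u j) <= E j.
  move=> jN; rewrite /E lerBrDr gerDl.
  exact: mulr_ge0_le0 mu_ge0 (compact_dot_le0 h0 (pu j jN) (pv j jN) (cp j jN)).
have -> : grid_norm h M (u 0%N) ^+ 2 + mu * grid_seminorm1 h M (u 0%N) ^+ 2
    + mu * h ^+ 2 / 12 * grid_norm h M (v 0%N) ^+ 2
    - mu * h ^+ 4 / 144 * grid_seminorm1 h M (v 0%N) ^+ 2 = h * E 0%N.
  rewrite !sqr_grid_norm ?sqr_grid_seminorm1 ?ltW // /E.
  rewrite -[- (mu * dot _ _ _)]mulrN.
  by rewrite (compact_dot_energy (pu _ _) (pv _ _) (cp _ _)) //; field.
rewrite (sqr_grid_norm _ _ (ltW h_gt0)) [2 * _]mulrCA (ler_pM2l h_gt0).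
have := le_trans (energy_ge k kN) ((EE k).1 kN).
(* [E 0 >= 0] allows passing from the bound [E 0] to [2 * E 0]. *)
by have := le_trans (dot_ge0 M (u 0%N)) (energy_ge 0%N (leq0n N)); lra.
Qed.
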